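(* Let $v_1\to v_2\to\cdots\to v_n$ be a directed path carrying only green pebbles, with $g_i\ge 0$ pebbles on $v_i$. Then the game value of this \textsc{blocking pebbles} position is the nimber $*\big(\bigoplus_{1\le k\le n/2} g_{2k}\big)$, the nim sum of the numbers of pebbles on the even-indexed vertices.
   Context: \textsc{Blocking pebbles} with green pebbles only is an impartial game on a finite directed acyclic graph with a number of (green) pebbles on each vertex. A move by either player: choose a vertex $v$ and either (1) move a positive number of pebbles from $v$ to a single in-neighbour $u$ of $v$ (arc $u\to v$) at no cost, or (2) remove two pebbles from $v$ and place one pebble on an out-neighbour $w$ of $v$ (arc $v\to w$). Normal play. $\oplus$ is nim sum (binary addition without carry); $*n$ is the nimber $n$. *)

(* Defs.v *)
From Stdlib Require Import PeanoNat.
From mathcomp Require Import all_boot.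

Set Implicit Arguments.
Unset Strict Implicit.
Unset Printing Implicit Defensive.

(* Conway's partizan games { L | R }. *)
Inductive game : Type :=
  Game (L R : Type) (left_option : L -> game) (right_option : R -> game).

(* The pair (x <= y, y <= x).  Conway's recursion
     x <= y  iff  no x^L satisfies y <= x^L and no y^R satisfies y^R <= x
   exchanges the two arguments, so both comparisons are computed together to
   make the recursion structural; see game_leE. *)
Fixpoint game_cmp (x : game) : game -> Prop * Prop :=
  match x with
  | Game xL xR xl xr =>
    fix cmp_x (y : game) : Prop * Prop :=
      match y with
      | Game yL yR yl yr =>
        ( (forall i : xL, ~ (game_cmp (xl i) y).2) /\
            (forall j : yR, ~ (cmp_x (yr j)).2),
          (forall i : yL, ~ (cmp_x (yl i)).1) /\
            (forall j : xR, ~ (game_cmp (xr j) y).1) )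
      end
  end.

Definition game_le (x y : game) : Prop := (game_cmp x y).1.

Definition game_eq (x y : game) : Prop := game_le x y /\ game_le y x.

Lemma game_cmp_sym x y :
  ((game_cmp x y).1 <-> (game_cmp y x).2) /\
  ((game_cmp x y).2 <-> (game_cmp y x).1).
Proof.
elim: x y => xL xR xl IHxl xr IHxr; elim=> yL yR yl IHyl yr IHyr.
split; split=> -[H1 H2]; split=> i Hi.
- exact: (H1 i (proj2 (proj2 (IHxl i (Game yl yr))) Hi)).
- exact: (H2 i (proj2 (proj2 (IHyr i)) Hi)).
- exact: (H1 i (proj1 (proj2 (IHxl i (Game yl yr))) Hi)).
- exact: (H2 i (proj1 (proj2 (IHyr i)) Hi)).
- exact: (H1 i (proj2 (proj1 (IHyl i)) Hi)).
- exact: (H2 i (proj2 (proj1 (IHxr i (Game yl yr))) Hi)).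
- exact: (H1 i (proj1 (proj1 (IHyl i)) Hi)).
- exact: (H2 i (proj1 (proj1 (IHxr i (Game yl yr))) Hi)).
Qed.

Lemma game_leE xL xR (xl : xL -> game) (xr : xR -> game)
    yL yR (yl : yL -> game) (yr : yR -> game) :
  let x := Game xl xr in let y := Game yl yr in
  game_le x y <->
  (forall i, ~ game_le y (xl i)) /\ (forall j, ~ game_le (yr j) x).
Proof.
move=> x y; split=> -[H1 H2]; split=> i Hi.
- exact: (H1 i (proj2 (proj2 (game_cmp_sym (xl i) y)) Hi)).
- exact: (H2 i (proj2 (proj2 (game_cmp_sym x (yr i))) Hi)).
- exact: (H1 i (proj1 (proj2 (game_cmp_sym (xl i) y)) Hi)).
- exact: (H2 i (proj1 (proj2 (game_cmp_sym x (yr i))) Hi)).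
Qed.

(* [move p q]: a player may move from p to q.  Both players have the same
   options, and normal play is built into the order on games. *)
Fixpoint impartial_game (T : Type) (move : T -> T -> Prop) (p : T)
    (a : Acc (fun q p' => move p' q) p) {struct a} : game :=
  let opt (s : {q : T | move p q}) :=
    impartial_game (Acc_inv a (proj2_sig s)) in
  Game opt opt.

Definition nim_move (m k : nat) : Prop := k < m.

Lemma nim_move_wf : well_founded (fun k m => nim_move m k).
Proof.
move=> n; have [m] := ubnP n; elim: m n => [n|m IHm n ltnm]; first by rewrite ltn0.
constructor=> k ltkn; apply: IHm; exact: leq_trans ltkn ltnm.
Qed.

(* The nimber *n = { *0, ..., *(n-1) | *0, ..., *(n-1) }. *)
Definition nimber (n : nat) : game := impartial_game (nim_move_wf n).

Record dag := Dag {
  vertex :> finType;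
  arc : rel vertex;
  arc_acyclic : forall u v, arc u v -> ~~ connect arc v u
}.

Inductive green_move (D : dag) (p : {ffun D -> nat}) : {ffun D -> nat} -> Prop :=
| move_backward (v u : D) (k : nat) :
    arc u v -> 0 < k <= p v ->
    green_move p [ffun x => if x == v then p x - k
                            else if x == u then p x + k else p x]
| move_forward (v w : D) :
    arc v w -> 2 <= p v ->
    green_move p [ffun x => if x == v then p x - 2
                            else if x == w then p x + 1 else p x].

(* Every move strictly decreases position_weight, since an in-neighbour weighs
   less and any vertex weighs less than twice any other. *)
Definition pebble_weight (D : dag) (v : D) : nat :=
  #|D|.+1 + #|[pred u | connect (@arc D) u v]|.

Definition position_weight (D : dag) (p : {ffun D -> nat}) : nat :=
  \sum_(v : D) p v * pebble_weight v.

Lemma arc_neq (D : dag) (u v : D) : arc u v -> u != v.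
Proof. by move=> uv; apply: contraTneq (arc_acyclic uv) => ->; rewrite connect0. Qed.

Lemma pebble_weight_arc (D : dag) (u v : D) :
  arc u v -> pebble_weight u < pebble_weight v.
Proof.
move=> uv; rewrite /pebble_weight ltn_add2l; apply/proper_card/properP; split.
  apply/subsetP=> x; rewrite !inE => xu.
  exact: connect_trans xu (connect1 uv).
by exists v; rewrite !inE ?connect0 // arc_acyclic.
Qed.

Lemma pebble_weight_double (D : dag) (v w : D) :
  pebble_weight w < 2 * pebble_weight v.
Proof.
rewrite /pebble_weight mul2n -addnn.
apply: (@leq_ltn_trans (#|D|.+1 + #|D|)); first by rewrite leq_add2l max_card.
by rewrite -addnA ltn_add2l; apply: leq_trans (leq_addl _ _); rewrite leq_addr.
Qed.

Lemma position_weight_upd (D : dag) (p : {ffun D -> nat}) (v w : D) a b :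
  v != w -> a <= p v -> b * pebble_weight w < a * pebble_weight v ->
  position_weight [ffun x => if x == v then p x - a
                             else if x == w then p x + b else p x]
    < position_weight p.
Proof.
move=> vw ap ab; rewrite /position_weight.
rewrite (bigD1 v) //= (bigD1 w) /=; last by rewrite eq_sym.
rewrite [X in _ < X](bigD1 v) //= [X in _ < _ + X](bigD1 w) /=; last by rewrite eq_sym.
rewrite !ffunE !eqxx eq_sym (negbTE vw) !addnA.
rewrite (eq_bigr (fun x => p x * pebble_weight x)); last first.
  by move=> x /andP[/negbTE xv /negbTE xw]; rewrite ffunE xv xw.
rewrite ltn_add2r mulnDl addnA addnAC ltn_add2r mulnBl.
by rewrite -[X in _ < X](@subnK (a * pebble_weight v)) ?leq_mul2r ?ap ?orbT // ltn_add2l.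
Qed.

Lemma green_move_wf (D : dag) :
  well_founded (fun q p : {ffun D -> nat} => green_move p q).
Proof.
move=> p; have [m] := ubnP (position_weight p).
elim: m p => [p|m IHm p ltm]; first by rewrite ltn0.
constructor=> q pq; apply: IHm.
apply: (leq_trans _ (ltm : position_weight p <= m)); case: pq => [v u k uv /andP[k0 kp]|v w vw p2].
  apply: position_weight_upd => //; first by rewrite eq_sym arc_neq.
  by rewrite ltn_pmul2l // pebble_weight_arc.
apply: position_weight_upd => //; first exact: arc_neq.
by rewrite mul1n pebble_weight_double.
Qed.

Definition green_pebbles (D : dag) (p : {ffun D -> nat}) : game :=
  impartial_game (green_move_wf p).

(* The ordinal i stands for the vertex v_(i+1). *)
Definition path_arc (n : nat) : rel 'I_n := fun i j => j == i.+1 :> nat.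

Lemma path_arc_acyclic n (u v : 'I_n) :
  path_arc u v -> ~~ connect (@path_arc n) v u.
Proof.
move=> /eqP uv; apply/negP => /connectP[s].
suff H : forall x : 'I_n, path (@path_arc n) x s -> x <= last x s.
  by move=> /H le E; move: le; rewrite -E uv ltnn.
elim: s => //= y s IHs x /andP[/eqP xy /IHs]; apply: leq_trans.
by rewrite xy leqnSn.
Qed.

Definition path_dag (n : nat) : dag := Dag (@path_arc_acyclic n).

(* Main.v *)
(** Two adjacent vertices of a path have indices of opposite parity, so every
    move changes the number of pebbles on exactly one even-indexed vertex and
    therefore changes the nim sum.  Conversely every even-indexed vertex has an
    in-neighbour, which is odd-indexed, so that any number of its pebbles can
    be discarded as in Nim; hence every smaller nim sum can be reached.  Thus
    the nim sum satisfies the recursion of the Grundy value. *)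

Require Import Defs.
From Stdlib Require Import PeanoNat.
From HB Require Import structures.
From mathcomp Require Import all_boot.

Set Implicit Arguments.
Unset Strict Implicit.
Unset Printing Implicit Defensive.

(** The mex recursion, split into its two halves. *)
Definition grundy_function (T : Type) (move : T -> T -> Prop) (f : T -> nat) :=
  (forall p q, move p q -> f q <> f p) /\
  (forall p k, k < f p -> exists2 q, move p q & f q = k).

(** If the values differ, the larger side has an option matching the smaller value, which by
    induction refutes either inequality; if they agree, no option matches. Both directions go
    together because [game_leE] swaps its arguments. *)
Lemma impartial_game_le (T T' : Type) (move : T -> T -> Prop)
    (move' : T' -> T' -> Prop) (f : T -> nat) (f' : T' -> nat) :
  grundy_function move f -> grundy_function move' f' ->
  forall p (a : Acc (fun q p => move p q) p)
         p' (a' : Acc (fun q p => move' p q) p'),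
  (game_le (impartial_game a) (impartial_game a') <-> f p = f' p') /\
  (game_le (impartial_game a') (impartial_game a) <-> f p = f' p').
Proof.
(* The induction runs on a copy of [a], as the game itself depends on [a]. *)
move=> [neq_f lt_f] [neq_f' lt_f'] p a; have acc_p := a.
elim: acc_p a => {}p _ IHp a p' a'; have acc_p' := a'.
elim: acc_p' a' => {}p' _ IHp' a'.
(* Exposing [Acc_intro] lets both games unfold. *)
case: a IHp' => a IHp'; case: a' => a'.
split; rewrite [impartial_game _]/= [X in game_le _ X]/= game_leE; split.
- case=> noL noR; case: (ltngtP (f p) (f' p')) => // lt_fp.
    have [q pq fq] := lt_f' _ _ lt_fp.
    by case: (noR (exist _ q pq)); apply/(proj2 (IHp' q pq (a' q pq))).
  have [q pq fq] := lt_f _ _ lt_fp.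
  by case: (noL (exist _ q pq)); apply/(proj2 (IHp q pq (a q pq) p' (Acc_intro _ a'))).
- move=> fp; split=> -[q pq] /=.
    move=> /(proj2 (IHp q pq (a q pq) p' (Acc_intro _ a'))).
    by rewrite -fp => /neq_f; apply.
  by move=> /(proj2 (IHp' q pq (a' q pq))) /esym; rewrite fp => /neq_f'; apply.
- case=> noL noR; case: (ltngtP (f p) (f' p')) => // lt_fp.
    have [q pq fq] := lt_f' _ _ lt_fp.
    by case: (noL (exist _ q pq)); apply/(proj1 (IHp' q pq (a' q pq))).
  have [q pq fq] := lt_f _ _ lt_fp.
  by case: (noR (exist _ q pq)); apply/(proj1 (IHp q pq (a q pq) p' (Acc_intro _ a'))).
- move=> fp; split=> -[q pq] /=.
    by move=> /(proj1 (IHp' q pq (a' q pq))) /esym; rewrite fp => /neq_f'; apply.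
  move=> /(proj1 (IHp q pq (a q pq) p' (Acc_intro _ a'))).
  by rewrite -fp => /neq_f; apply.
Qed.

Lemma grundy_function_nim : grundy_function nim_move id.
Proof.
by split=> [p q ltqp eq_qp|p k ltkp]; [rewrite /nim_move eq_qp ltnn in ltqp|exists k].
Qed.

Lemma impartial_game_nimber (T : Type) (move : T -> T -> Prop) (f : T -> nat)
    (p : T) (a : Acc (fun q p => move p q) p) :
  grundy_function move f -> game_eq (impartial_game a) (nimber (f p)).
Proof.
move=> Gf.
have [H1 H2] := impartial_game_le Gf grundy_function_nim a (nim_move_wf (f p)).
by split; [apply/H1 | apply/H2].
Qed.

(** Lets nim sums be split and reordered as big operators. *)
HB.instance Definition _ :=
  Monoid.isComLaw.Build nat 0 Nat.lxor
    (fun x y z => esym (Nat.lxor_assoc x y z)) Nat.lxor_comm Nat.lxor_0_l.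

Lemma lxor_invol x y : Nat.lxor x (Nat.lxor x y) = y.
Proof. by rewrite -Nat.lxor_assoc Nat.lxor_nilpotent Nat.lxor_0_l. Qed.

(** Induction on [b] by halving: at [b = 0] the halves coincide and the last digits decide. *)
Lemma ltn_testbit b x y :
  Nat.testbit x b = false -> Nat.testbit y b ->
  (forall c, b < c -> Nat.testbit x c = Nat.testbit y c) -> x < y.
Proof.
elim: b x y => [|b IHb] x y xb yb eq_xy; rewrite (Nat.div2_odd x) (Nat.div2_odd y).
  have -> : Nat.div2 x = Nat.div2 y.
    by apply: Nat.bits_inj => c; apply: (eq_xy c.+1).
  move: xb yb; rewrite !Nat.bit0_odd => -> -> /=.
  by apply/ltP; rewrite Nat.add_0_r Nat.add_1_r.
have lt_xy : Nat.div2 x < Nat.div2 y.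
  by apply: IHb => // c ltbc; apply: (eq_xy c.+1).
rewrite -[X in X < _]/(2 * Nat.div2 x + nat_of_bool (Nat.odd x)).
rewrite -[X in _ < X]/(2 * Nat.div2 y + nat_of_bool (Nat.odd y)).
apply: leq_trans (leq_addr _ _).
apply: (@leq_trans (2 * (Nat.div2 x).+1)); last by rewrite leq_mul2l.
by rewrite mulnS addnC ltn_add2r; case: (Nat.odd x).
Qed.

(** The leading bit of [Nat.lxor x y] is the highest place where [x] and [y] differ. *)
Lemma testbit_lxor_log2 x y :
  x <> y -> Nat.testbit x (Nat.log2 (Nat.lxor x y)) =
            ~~ Nat.testbit y (Nat.log2 (Nat.lxor x y)).
Proof.
move=> neq_xy; have nz : Nat.lxor x y <> 0 by move/Nat.lxor_eq.
move: (Nat.bit_log2 _ nz); rewrite Nat.lxor_spec.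
by case: (Nat.testbit x _); case: (Nat.testbit y _).
Qed.

Lemma testbit_above_log2_lxor x y c :
  Nat.log2 (Nat.lxor x y) < c -> Nat.testbit x c = Nat.testbit y c.
Proof.
move=> /ltP ltc; move: (Nat.bits_above_log2 _ _ ltc); rewrite Nat.lxor_spec.
by case: (Nat.testbit x _); case: (Nat.testbit y _).
Qed.

Lemma testbit_log2_lxor_ltn x y :
  x < y -> Nat.testbit y (Nat.log2 (Nat.lxor x y)).
Proof.
move=> ltxy; have neq_xy : x <> y by move=> eq_xy; rewrite eq_xy ltnn in ltxy.
apply/negPn/negP => yb; have := ltxy; rewrite ltnNge => /negP; apply; apply: ltnW.
apply: (@ltn_testbit (Nat.log2 (Nat.lxor x y))); first exact/negbTE.
  by rewrite testbit_lxor_log2.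
by move=> c ltc; rewrite (testbit_above_log2_lxor ltc).
Qed.

(** Adding [d] clears the bit [Nat.log2 d] of [x] and keeps all higher bits. *)
Lemma ltn_lxor x d : d <> 0 -> Nat.testbit x (Nat.log2 d) -> Nat.lxor x d < x.
Proof.
move=> nz xb; apply: (ltn_testbit (b := Nat.log2 d)) => //.
  by rewrite Nat.lxor_spec xb Nat.bit_log2.
move=> c /ltP ltc; rewrite Nat.lxor_spec (Nat.bits_above_log2 _ _ ltc).
by case: Nat.testbit.
Qed.

Lemma testbit_big_lxor (I : finType) (P : pred I) (F : I -> nat) b :
  Nat.testbit (\big[Nat.lxor/0]_(i | P i) F i) b ->
  exists2 i, P i & Nat.testbit (F i) b.
Proof.
case: (pickP (fun i => P i && Nat.testbit (F i) b)) => [i /andP[Pi bi] _|none].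
  by exists i.
elim/big_rec: _ => [|i x Pi IHx]; first by rewrite Nat.bits_0.
by rewrite Nat.lxor_spec; move: (none i); rewrite Pi /= => ->; case: Nat.testbit IHx.
Qed.

(** Bouton's argument: the highest bit where [k] and the total differ is set in the total, hence in
    some heap. *)
Lemma nim_winning_move (I : finType) (P : pred I) (F : I -> nat) k :
  k < \big[Nat.lxor/0]_(i | P i) F i ->
  exists2 i, P i &
    Nat.lxor (F i) (Nat.lxor k (\big[Nat.lxor/0]_(i | P i) F i)) < F i.
Proof.
move=> ltk; have [i Pi bi] := testbit_big_lxor (testbit_log2_lxor_ltn ltk).
exists i => //; apply: ltn_lxor => // /Nat.lxor_eq eqk.
by rewrite -eqk ltnn in ltk.
Qed.

Lemma big_lxor_upd (I : finType) (P : pred I) (F F' : I -> nat) i :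
  P i -> (forall j, P j -> j != i -> F' j = F j) ->
  \big[Nat.lxor/0]_(j | P j) F' j =
  Nat.lxor (Nat.lxor (F i) (F' i)) (\big[Nat.lxor/0]_(j | P j) F j).
Proof.
move=> Pi eqF; rewrite (bigD1 i) //= [in RHS](bigD1 i) //=.
rewrite (eq_bigr F) => [|j /andP[]]; last exact: eqF.
by rewrite [Nat.lxor (F i) (F' i)]Nat.lxor_comm Nat.lxor_assoc lxor_invol.
Qed.

Definition even_nim_sum (n : nat) (g : {ffun 'I_n -> nat}) : nat :=
  \big[Nat.lxor/0]_(i < n | ~~ odd i.+1) g i.

Lemma even_nim_sum_neq (n : nat) (g h : {ffun 'I_n -> nat}) (i : 'I_n) :
  ~~ odd i.+1 -> (forall j : 'I_n, ~~ odd j.+1 -> j != i -> h j = g j) ->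
  h i <> g i -> even_nim_sum h <> even_nim_sum g.
Proof.
move=> Pi eqg neq; rewrite /even_nim_sum (big_lxor_upd (F := g) Pi eqg).
move: (\big[_/_]_(_ < n | _) _) => X eqX; apply/neq/esym/Nat.lxor_eq.
by rewrite -[LHS]Nat.lxor_0_r -(Nat.lxor_nilpotent X) -Nat.lxor_assoc eqX.
Qed.

(** Covers both kinds of move: [a = b = k] backward, [a = 2] and [b = 1] forward. *)
Lemma even_nim_sum_transfer (n : nat) (g : {ffun 'I_n -> nat}) (v w : 'I_n) a b :
  path_arc v w || path_arc w v -> 0 < a <= g v -> 0 < b ->
  even_nim_sum [ffun x => if x == v then g x - a
                          else if x == w then g x + b else g x]
    <> even_nim_sum g.
Proof.
move=> vw /andP[a0 ag] b0.
have odd_vw : odd v = ~~ odd w.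
  by case/orP: vw => /eqP -> /=; rewrite ?negbK.
(* Ordinals count from 0, so an odd ordinal is an even-indexed vertex: it is [v] here, and [w] in
   the other case. *)
have [ov|ev] := boolP (odd v).
  apply: (even_nim_sum_neq (i := v)); first by rewrite /= negbK.
    move=> j; rewrite /= negbK ffunE => oj /negbTE ->.
    by case: eqP => // ejw; rewrite odd_vw -ejw oj in ov.
  rewrite ffunE eqxx => eqg; move: (ltn_subrL a (g v)).
  by rewrite eqg ltnn a0 (leq_trans a0 ag).
have ow : odd w by rewrite odd_vw negbK in ev.
apply: (even_nim_sum_neq (i := w)); first by rewrite /= negbK.
  move=> j; rewrite /= negbK ffunE => oj /negbTE ->.
  by case: eqP => // ejv; rewrite -ejv oj in ev.
rewrite ffunE eqxx; case: eqP => [ewv|_]; first by rewrite -ewv ow in ev.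
by move=> eqg; move: b0; rewrite -(ltn_add2l (g w)) addn0 eqg ltnn.
Qed.

Lemma grundy_function_even_nim_sum (n : nat) :
  grundy_function (@green_move (path_dag n)) (@even_nim_sum n).
Proof.
split=> [p q [v u k uv kp|v w vw p2]|p k ltk].
- by apply: even_nim_sum_transfer; rewrite ?(uv : path_arc u v) ?orbT //; case/andP: kp.
- by apply: even_nim_sum_transfer; rewrite ?(vw : path_arc v w).
have [v Pv] := nim_winning_move ltk.
(* [t] is what the nim move leaves on [v]; the surplus [p v - t] goes back to [u], which is
   odd-indexed and does not count. *)
rewrite -/(even_nim_sum p); set t := Nat.lxor _ _ => lttp.
have ov : odd v by rewrite /= negbK in Pv.
have v0 : 0 < v by case: (nat_of_ord v) ov.
have uP : v.-1 < n by apply: leq_ltn_trans (leq_pred _) (ltn_ord v).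
pose u : path_dag n := Ordinal uP.
have uv : @Defs.arc (path_dag n) u v by rewrite /= /path_arc /= prednK.
exists [ffun x => if x == v then p x - (p v - t)
                  else if x == u then p x + (p v - t) else p x].
  by apply: move_backward; rewrite // subn_gt0 lttp leq_subr.
rewrite /even_nim_sum (big_lxor_upd (F := p) Pv) => [|j Pj neq_jv].
  rewrite ffunE eqxx subKn 1?ltnW // -/(even_nim_sum p) /t lxor_invol.
  by rewrite Nat.lxor_assoc Nat.lxor_nilpotent Nat.lxor_0_r.
rewrite ffunE (negbTE neq_jv); case: eqP => // ju.
by move: Pj; rewrite ju -[in odd _]/(v.-1.+1) prednK // ov.
Qed.

Theorem theorem8 (n : nat) (g : {ffun 'I_n -> nat}) :
  game_eq (@green_pebbles (path_dag n) g)
          (nimber (\big[Nat.lxor/0]_(i < n | ~~ odd i.+1) g i)).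
Proof.
exact: (impartial_game_nimber _ (@grundy_function_even_nim_sum n)).
Qed.
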